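(* Let $K$ be either the field $\mathbb{Q}$ of rational numbers or a real quadratic field, i.e. a subfield of $\mathbb{R}$ with $[K:\mathbb{Q}]\le 2$. Fix a $\mathbb{Q}$-vector space basis of $K$ and let $\delta_K(R)$ be the corresponding density function of the set $Tri$ of trisection numbers. Then the density $\delta_K(Tri)=\lim_{R\to\infty}\delta_K(R)$ exists and $\delta_K(Tri)=0$.
   Context: Constructibility. Let $S\subseteq\mathbb{R}^2$ contain $(0,0)$ and $(1,0)$. A point is constructible over $S$ if it can be obtained from points of $S$ by a finite sequence of straightedge-and-compass steps: (1) given two distinct points already available, one may draw the line through them, or the circle centered at one of them and passing through the other; (2) given two lines, two circles, or a line and a circle already drawn, one may add their intersection points. $C(S)$ denotes the set of all points constructible over $S$. Trisectability. An angle $\alpha$ (in radians) is identified with the point $(\cos\alpha,\sin\alpha)$ of the unit circle. $\alpha$ is trisectable if $(\cos(\alpha/3),\sin(\alpha/3))\in C(\{(0,0),(1,0),(\cos\alpha,\sin\alpha)\})$. A trisection number is a real number of the form $2\cos\alpha$ with $\alpha$ trisectable; $Tri\subseteq[-2,2]$ is the set of all trisection numbers. Height and density. Let $K$ be a subfield of $\mathbb{R}$ of finite degree $k$ over $\mathbb{Q}$, with a fixed $\mathbb{Q}$-basis $v_1,\dots,v_k$. Every $x\in K$ can be written uniquely as $x=(a_1v_1+\dots+a_kv_k)/b$ with integers $a_1,\dots,a_k,b$ having no common prime factor and $b>0$; set $h_K(x)=\max\{|a_1|,\dots,|a_k|,b\}$. For real $R>0$ let $B_K(R)=\{x\in K: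 h_K(x)\le R\}$, a finite set. For sufficiently large $R$, $$\delta_K(R)=\frac{|Tri\cap B_K(R)\cap[-2,2]|}{|B_K(R)\cap[-2,2]|}.$$ *)

(* Defs.v *)
From HB Require Import structures.
From mathcomp Require Import all_boot all_order all_algebra.
From mathcomp Require Import finmap ring.
From mathcomp Require Import all_classical all_reals all_analysis.
Import Order.TTheory GRing.Theory Num.Theory.
Import numFieldNormedType.Exports.

Set Implicit Arguments.
Unset Strict Implicit.
Unset Printing Implicit Defensive.

Local Open Scope classical_set_scope.
Local Open Scope ring_scope.

Section Constructibility.
Variable R : realType.

Definition line (A B : R * R) : set (R * R) :=
  [set P | exists t : R,
    P = (A.1 + t * (B.1 - A.1), A.2 + t * (B.2 - A.2))].

Definition circle (O A : R * R) : set (R * R) :=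
  [set P | (P.1 - O.1) ^+ 2 + (P.2 - O.2) ^+ 2 =
           (A.1 - O.1) ^+ 2 + (A.2 - O.2) ^+ 2].

(* Curves are compared as point sets, so [D <> E] only rules out intersecting
   a line or a circle with itself. *)
Inductive constructible (S : set (R * R)) : R * R -> Prop :=
| constructible_given P : S P -> constructible S P
| constructible_meet D E P :
    drawn S D -> drawn S E -> D <> E -> D P -> E P -> constructible S P
with drawn (S : set (R * R)) : set (R * R) -> Prop :=
| drawn_line A B :
    constructible S A -> constructible S B -> A <> B -> drawn S (line A B)
| drawn_circle O A :
    constructible S O -> constructible S A -> O <> A -> drawn S (circle O A).

Definition angle_point (alpha : R) : R * R := (cos alpha, sin alpha).

Definition trisectable (alpha : R) : Prop :=
  constructible [set (0, 0); (1, 0); angle_point alpha]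
                (angle_point (alpha / 3)).

Definition Tri : set R :=
  [set x | exists2 alpha, trisectable alpha & x = 2 * cos alpha].

End Constructibility.

Arguments Tri {R}.

Section Density.
Variable R : realType.

Definition rat_basis (K : {pred R}) (k : nat) (v : 'I_k -> R) : Prop :=
  [/\ forall i, v i \in K,
      forall q : 'I_k -> rat,
        \sum_i ratr (q i) * v i = 0 -> forall i, q i = 0
    & forall x, x \in K -> exists q : 'I_k -> rat, x = \sum_i ratr (q i) * v i].

Definition reduced_form (k : nat) (v : 'I_k -> R) (x : R)
    (a : 'I_k -> int) (b : nat) : Prop :=
  [/\ (0 < b)%N,
      ~ (exists p : nat, [/\ prime p, (p %| b)%N & forall i, (p %| `|a i|)%N])
    & x = (\sum_i (a i)%:~R * v i) / b%:R].

(* When [v] is a rational basis of a field containing [x], the reduced form of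
   [x] exists and is unique; elsewhere the value is irrelevant. *)
Definition height (k : nat) (v : 'I_k -> R) (x : R) : nat :=
  xget 0%N [set h | exists a b,
    reduced_form v x a b /\ h = maxn (\max_(i < k) `|a i|%N) b].

Definition height_ball (K : {pred R}) (k : nat) (v : 'I_k -> R) (r : R) :
  set R := [set x | x \in K /\ (height v x)%:R <= r].

(* [fset_set] of an infinite set is empty, but height balls are finite, see
   [finite_height_ball] below. *)
Definition ncard (A : set R) : nat := #|` fset_set A|.

Definition density (T : set R) (K : {pred R}) (k : nat) (v : 'I_k -> R)
    (r : R) : R :=
  (ncard (T `&` height_ball K v r `&` `[(- 2), 2]))%:R /
  (ncard (height_ball K v r `&` `[(- 2), 2]))%:R.

Lemma reduced_form_exists (K : {pred R}) k (v : 'I_k -> R) x :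
  rat_basis K v -> x \in K -> exists a b, reduced_form v x a b.
Proof.
case=> _ _ span /span[q xE].
have Pex : exists b, (0 < b)%N && `[< exists a : 'I_k -> int,
    x = (\sum_i (a i)%:~R * v i) / b%:R >].
  exists (\prod_i `|denq (q i)|)%N; apply/andP; split.
    by rewrite prodn_gt0// => i; rewrite absz_gt0 denq_neq0.
  apply/asboolP.
  exists (fun i => (numq (q i) * \prod_(j | j != i) (denq (q j)))%R).
  rewrite xE mulr_suml; apply: eq_bigr => i _.
  have dE (j : 'I_k) : (`|denq (q j)|%N)%:R = (denq (q j))%:~R :> R.
    by rewrite -{2}absz_denq.
  rewrite natr_prod (eq_bigr _ (fun j _ => dE j)) intrM rmorph_prod/=.
  rewrite [X in _ / X](bigD1 i)//= /ratr.
  set P := \prod_(_ | _) _.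
  have P0 : P != 0.
    by apply/prodf_neq0 => j _; rewrite intr_eq0 denq_neq0.
  have d0 : (denq (q i))%:~R != 0 :> R by rewrite intr_eq0 denq_neq0.
  by field; rewrite P0.
case: (ex_minnP Pex) => b /andP[b0 /asboolP[a xab]] bmin.
exists a, b; split=> // -[p [pp pb pa]].
have pK : (p * (b %/ p) = b)%N by rewrite mulnC divnK.
have : (b <= b %/ p)%N.
  apply: bmin; rewrite divn_gt0 ?prime_gt0// dvdn_leq//=.
  apply/asboolP; exists (fun i => (a i %/ p%:Z)%Z).
  have p0 : p%:R != 0 :> R by rewrite pnatr_eq0 -lt0n prime_gt0.
  have aE i : (a i)%:~R = p%:R * ((a i %/ p%:Z)%Z)%:~R :> R.
    by rewrite -{1}(@divzK p%:Z (a i)) ?intrM 1?mulrC// dvdzE/=.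
  rewrite xab -[in LHS]pK natrM invfM mulrA; congr (_ / _).
  rewrite mulr_suml; apply: eq_bigr => i _.
  by rewrite aE; field.
by rewrite leqNgt ltn_Pdiv// prime_gt1.
Qed.

Lemma finite_height_ball (K : {pred R}) k (v : 'I_k -> R) r :
  rat_basis K v -> finite_set (height_ball K v r).
Proof.
move=> Kv; have [n rn] : exists n : nat, r < n%:R.
  by exists (Num.truncn r).+1; exact: truncnS_gt.
pose F (u : {ffun 'I_k -> 'I_n.+1 * bool} * 'I_n.+1) : R :=
  (\sum_i ((-1) ^+ (u.1 i).2 * (u.1 i).1%:R) * v i) / u.2%:R.
apply: (@sub_finite_set _ _ (F @` setT)); last first.
  by apply: finite_image; exact: finite_finset.
move=> x [xK hx].
have [a0 [b0 rab0]] := reduced_form_exists Kv xK.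
have /(xgetPex 0%N) : exists h, [set h | exists a b,
    reduced_form v x a b /\ h = maxn (\max_(i < k) `|a i|%N) b] h.
  by exists (maxn (\max_(i < k) `|a0 i|%N) b0); exists a0, b0.
rewrite -/(height v x) => -[a [b [[_ _ xE] hE]]].
have hn : (height v x <= n)%N.
  by apply: ltnW; rewrite -(ltr_nat R); exact: le_lt_trans hx rn.
move: hn; rewrite hE geq_max => /andP[/bigmax_leqP an bn].
exists ([ffun i => (inord `|a i|%N, a i < 0)], inord b) => //.
rewrite /F/= inordK// xE; congr (_ / _); apply: eq_bigr => i _.
rewrite ffunE/= inordK ?ltnS ?an//; congr (_ * _).
by rewrite [in RHS](intEsign (a i)) intrM rmorphXn/= rmorphN1.
Qed.

End Density.

(* Main.v *)
Require Import Defs.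
From mathcomp Require Import all_boot all_order all_algebra.
From mathcomp Require Import finmap ring lra zify.
From mathcomp Require Import all_classical all_reals all_analysis.
Import Order.TTheory GRing.Theory Num.Theory.
Import numFieldNormedType.Exports.
Local Open Scope classical_set_scope.
Local Open Scope ring_scope.

(** If x = 2 cos alpha lies in K and alpha is trisectable, then
    y = 2 cos (alpha / 3) is a root of X^3 - 3 X - x lying in a tower of square
    root extensions of K. A cubic with a root in F(sqrt d) has a root in F, so
    x = t^3 - 3 t for some t in K.
    Let k = [K : Q]. Such a t is a root of an integer polynomial of degree 2.
    If c0 is the leading coefficient of its primitive polynomial, then c0^3 is
    the one of x, and hence divides an integer of size O(r^k) when x has height
    at most r. As the conjugate of t is controlled by that of x, the three
    coefficients are all O(r^(k/3)), which leaves O(r^k) values of t.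
    On the other hand, for every L and large r, the fractions
    (2^i v_0 + a_1 v_1 + ...) / b with i < L and b odd provide at least
    c L r^k points of height at most r in [-2, 2], with c independent of L. *)

Set Implicit Arguments.
Unset Strict Implicit.
Unset Printing Implicit Defensive.

(** * Points constructible over a subfield *)

Section QuadraticTowers.
Variable R : realType.
Implicit Types (F K : set R) (x y d : R) (A B O P : R * R).

(** The set version of [divring_closed]; a quotient by 0 is 0, which stays in the set. *)
Definition subfield F :=
  [/\ F 1, forall x y, F x -> F y -> F (x - y)
    & forall x y, F x -> F y -> F (x / y)].

Section SubfieldTheory.
Variables (F : set R) (sF : subfield F).

Lemma subfield1 : F 1. Proof. by case: sF. Qed.
Lemma subfieldB x y : F x -> F y -> F (x - y). Proof. by case: sF => _ + _; apply. Qed.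
Lemma subfield_div x y : F x -> F y -> F (x / y). Proof. by case: sF => _ _; apply. Qed.
Lemma subfield0 : F 0. Proof. by rewrite -(subrr 1); apply: subfieldB; exact: subfield1. Qed.
Lemma subfieldN x : F x -> F (- x).
Proof. by rewrite -sub0r; apply: subfieldB; exact: subfield0. Qed.
Lemma subfieldD x y : F x -> F y -> F (x + y).
Proof. by move=> Fx Fy; rewrite -[y]opprK; apply/subfieldB/subfieldN. Qed.
Lemma subfieldV x : F x -> F x^-1.
Proof. by rewrite -div1r; apply: subfield_div; exact: subfield1. Qed.
Lemma subfieldM x y : F x -> F y -> F (x * y).
Proof. by move=> Fx Fy; rewrite -[y]invrK; apply/subfield_div/subfieldV. Qed.
Lemma subfieldX x n : F x -> F (x ^+ n).
Proof.
move=> Fx; elim: n => [|n IH]; first by rewrite expr0; exact: subfield1.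
by rewrite exprS; exact: subfieldM.
Qed.
Lemma subfield_nat n : F n%:R.
Proof.
elim: n => [|n IH]; first exact: subfield0.
by rewrite -natr1; apply: subfieldD => //; exact: subfield1.
Qed.
End SubfieldTheory.

Ltac in_subfield sF :=
  repeat first [assumption | apply: (subfield1 sF) | apply: (subfield0 sF)
    | apply: (subfield_nat sF) | apply: (subfieldN sF) | apply: (subfieldD sF)
    | apply: (subfieldX sF) | apply: (subfieldM sF) | apply: (subfieldV sF)].

Definition sqrt_ext F d : set R :=
  [set x | exists a b, [/\ F a, F b & x = a + b * Num.sqrt d]].

Lemma sqrt_extS F d : subfield F -> F `<=` sqrt_ext F d.
Proof. by move=> sF x Fx; exists x, 0; split=> //; [exact: subfield0|ring]. Qed.

Lemma subfield_sqrt_ext F d : subfield F -> F d -> 0 <= d ->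
  subfield (sqrt_ext F d).
Proof.
move=> sF Fd d0; have w2 : Num.sqrt d * Num.sqrt d = d by rewrite -expr2 sqr_sqrtr.
split; first by apply: sqrt_extS => //; exact: subfield1.
  move=> _ _ [a [b [Fa Fb ->]]] [a' [b' [Fa' Fb' ->]]].
  by exists (a - a'), (b - b'); split; [in_subfield sF..|ring].
move=> _ _ [a [b [Fa Fb ->]]] [a' [b' [Fa' Fb' ->]]].
have [->|y0] := eqVneq (a' + b' * Num.sqrt d) 0.
  by rewrite invr0 mulr0; apply: sqrt_extS => //; exact: subfield0.
(* [d] may be a square in [F], and then the conjugate used to rationalise can vanish; in that case
   the denominator is [2 * a']. *)
have [y1|y1] := eqVneq (a' - b' * Num.sqrt d) 0.
  have E : a' + b' * Num.sqrt d = 2 * a' by rewrite -[a' + _]addr0 -y1; ring.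
  move: y0; rewrite E => y0.
  exists (a / (2 * a')), (b / (2 * a')); split; first by in_subfield sF.
    by in_subfield sF.
  by field; move: y0; rewrite mulf_eq0 pnatr_eq0.
have E : a' ^+ 2 - b' ^+ 2 * d = (a' + b' * Num.sqrt d) * (a' - b' * Num.sqrt d).
  by rewrite -[in LHS]w2; ring.
exists ((a * a' - b * b' * d) / (a' ^+ 2 - b' ^+ 2 * d)),
  ((b * a' - a * b') / (a' ^+ 2 - b' ^+ 2 * d)).
split; [by in_subfield sF| by in_subfield sF|].
rewrite E; move: y0 y1 w2 {E}; set w := Num.sqrt d => y0 y1 <-; field.
by rewrite y0 y1.
Qed.

Inductive sqrt_tower K : set R -> Prop :=
| sqrt_tower_base : sqrt_tower K K
| sqrt_tower_ext F d : sqrt_tower K F -> F d -> 0 <= d ->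
    sqrt_tower K (sqrt_ext F d).

Lemma sqrt_tower_subfield K F : subfield K -> sqrt_tower K F -> subfield F.
Proof. by move=> sK; elim=> // G d _; exact: subfield_sqrt_ext. Qed.

Lemma sqrt_tower_sub K F : subfield K -> sqrt_tower K F -> K `<=` F.
Proof.
move=> sK; elim=> // G d tG KG _ _ x /KG Gx.
by apply: sqrt_extS => //; exact: sqrt_tower_subfield tG.
Qed.

(** The square roots that build [F] are adjoined to [G] in the same order. This merges the towers
    that an induction provides for separate points. *)
Lemma sqrt_tower_directed K F G : subfield K -> sqrt_tower K F ->
  sqrt_tower K G -> exists2 H, sqrt_tower K H & F `<=` H /\ G `<=` H.
Proof.
move=> sK tF tG; elim: tF => [|F' d tF' [H tH [FH GH]] F'd d0].
  by exists G => //; split=> //; exact: sqrt_tower_sub.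
have sH := sqrt_tower_subfield sK tH.
exists (sqrt_ext H d); first by apply: sqrt_tower_ext => //; exact: FH.
split; last by move=> x /GH; exact: sqrt_extS.
by move=> _ [a [b [/FH Ha /FH Hb ->]]]; exists a, b.
Qed.

(* If a + b sqrt d is a root of X^3 - 3X - x then so is its conjugate, and the
   three roots add up to 0, so the third one is - 2 a. *)
Lemma cubic_root_sqrt_ext F d x y : subfield F -> F d -> 0 <= d -> F x ->
  sqrt_ext F d y -> y ^+ 3 - 3 * y = x ->
  exists2 t, F t & t ^+ 3 - 3 * t = x.
Proof.
move=> sF Fd d0 Fx [a [b [Fa Fb ->]]].
set w := Num.sqrt d => yx.
have w2 : w ^+ 2 = d by rewrite sqr_sqrtr.
have [Fw|nFw] := pselect (F w).
  by exists (a + b * w) => //; in_subfield sF.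
have E : (a ^+ 3 + 3 * a * b ^+ 2 * d - 3 * a - x) +
    (3 * a ^+ 2 * b + b ^+ 3 * d - 3 * b) * w = 0 by rewrite -yx -w2; ring.
(* As [w] is not in [F], its coefficient must vanish: otherwise [w] would be a quotient of elements
   of [F]. *)
have [c0|c0] := eqVneq (3 * a ^+ 2 * b + b ^+ 3 * d - 3 * b) 0; last first.
  case: nFw.
  have -> : w = - (a ^+ 3 + 3 * a * b ^+ 2 * d - 3 * a - x) /
                (3 * a ^+ 2 * b + b ^+ 3 * d - 3 * b).
    apply: (mulIf c0); rewrite divfK//.
    by apply/eqP; rewrite -addr_eq0 addrC [w * _]mulrC E.
  by in_subfield sF.
have [b0|b0] := eqVneq b 0.
  by exists a => //; rewrite -yx b0 mul0r addr0.
exists (- 2 * a); first by in_subfield sF.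
have {}c0 : 3 * a ^+ 2 + b ^+ 2 * d - 3 = 0 by apply: (mulfI b0); rewrite mulr0 -c0; ring.
move: E; rewrite (_ : 3 * a ^+ 2 * b + _ - _ = b * (3 * a ^+ 2 + b ^+ 2 * d - 3));
  last by ring.
rewrite c0 mulr0 mul0r addr0 => /subr0_eq <-.
apply/eqP; rewrite -subr_eq0; apply/eqP.
by transitivity (-3 * a * (3 * a ^+ 2 + b ^+ 2 * d - 3)); [ring|rewrite c0 mulr0].
Qed.

(** The root is pushed down the tower, one square root at a time. *)
Lemma cubic_root_sqrt_tower K F x y : subfield K -> sqrt_tower K F -> K x ->
  F y -> y ^+ 3 - 3 * y = x -> exists2 t, K t & t ^+ 3 - 3 * t = x.
Proof.
move=> sK tF Kx; elim: tF y => [|G d tG IH Gd d0] y Fy yx; first by exists y.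
have [||t Gt tx] := cubic_root_sqrt_ext _ Gd d0 _ Fy yx.
- exact: sqrt_tower_subfield tG.
- exact: (sqrt_tower_sub sK tG).
exact: IH Gt tx.
Qed.

(** * Intersections of lines and circles over a subfield *)

Definition points F : set (R * R) := [set P | F P.1 /\ F P.2].

(** The discriminant equals [(2 * a * t + b) ^+ 2], so it is nonnegative and its square root is
    [2 * a * t + b] up to sign. *)
Lemma quadratic_root_sqrt_ext F a b c t : subfield F -> F a -> F b -> F c ->
  a != 0 -> a * t ^+ 2 + b * t + c = 0 ->
  exists d, [/\ F d, 0 <= d & sqrt_ext F d t].
Proof.
move=> sF Fa Fb Fc a0 E.
have D : b ^+ 2 - 4 * a * c = (2 * a * t + b) ^+ 2.
  by apply/eqP; rewrite -subr_eq0; apply/eqP;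
    transitivity (- 4 * a * (a * t ^+ 2 + b * t + c)); [ring|rewrite E mulr0].
exists (b ^+ 2 - 4 * a * c); split; first by in_subfield sF.
  by rewrite D sqr_ge0.
rewrite /sqrt_ext D sqrtr_sqr/=.
have a20 : 2 * a != 0 by rewrite mulf_neq0// pnatr_eq0.
have [p|p] := lerP 0 (2 * a * t + b).
  exists (- b / (2 * a)), (1 / (2 * a)); split; [by in_subfield sF..|].
  by rewrite ger0_norm//; field.
exists (- b / (2 * a)), (- 1 / (2 * a)); split; [by in_subfield sF..|].
by rewrite ltr0_norm//; field.
Qed.

(** [B] is a direction vector here. Substituting the parametrised point into the circle equation
    gives a quadratic equation in [t] whose leading coefficient is the squared norm of [B]. *)
Lemma line_circle_sqrt_ext F A B O Q (t : R) : subfield F ->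
  points F A -> points F B -> points F O -> points F Q -> B != 0 ->
  circle O Q (A.1 + t * B.1, A.2 + t * B.2) ->
  exists d, [/\ F d, 0 <= d & points (sqrt_ext F d) (A.1 + t * B.1, A.2 + t * B.2)].
Proof.
move=> sF [FA1 FA2] [FB1 FB2] [FO1 FO2] [FQ1 FQ2] B0; rewrite /circle/= => E.
have [|||||d [Fd d0 dt]] := @quadratic_root_sqrt_ext F (B.1 ^+ 2 + B.2 ^+ 2)
  (2 * (B.1 * (A.1 - O.1) + B.2 * (A.2 - O.2)))
  ((A.1 - O.1) ^+ 2 + (A.2 - O.2) ^+ 2 - (Q.1 - O.1) ^+ 2 - (Q.2 - O.2) ^+ 2) t sF.
- by in_subfield sF.
- by in_subfield sF.
- by in_subfield sF.
- rewrite paddr_eq0 ?sqr_ge0// !sqrf_eq0; apply: contra B0 => /andP[/eqP B1 /eqP B2].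
  by rewrite -pair_eqE/= B1 B2 !eqxx.
- rewrite -[RHS](subrr ((Q.1 - O.1) ^+ 2 + (Q.2 - O.2) ^+ 2)) -[X in _ = X - _]E; ring.
exists d; split=> //; have sG := subfield_sqrt_ext sF Fd d0.
by split=> /=; apply: (subfieldD sG); try apply: (subfieldM sG) => //; exact: sqrt_extS.
Qed.

Lemma circle_eq O A A' P : circle O A P -> circle O A' P -> circle O A = circle O A'.
Proof. by rewrite /circle/= => E E'; apply/seteqP; split => Q /= ->; rewrite -?E -?E'. Qed.

(** Serves to exclude a zero determinant when two distinct lines meet. *)
Lemma line_eq A B A' B' P : A <> B -> A' <> B' ->
  (B.1 - A.1) * (B'.2 - A'.2) = (B.2 - A.2) * (B'.1 - A'.1) ->
  line A B P -> line A' B' P -> line A B = line A' B'.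
Proof.
wlog suff : A B A' B' / A <> B -> A' <> B' ->
    (B.1 - A.1) * (B'.2 - A'.2) = (B.2 - A.2) * (B'.1 - A'.1) ->
    line A B P -> line A' B' P -> line A B `<=` line A' B'.
  move=> H AB AB' E lP lP'; apply/seteqP; split; first exact: H.
  by apply: H => //; rewrite mulrC -E mulrC.
move=> AB AB' E [t tE] [t' tE'] Q [s ->]; rewrite /line/=.
move: tE'; rewrite tE => -[E1 E2].
set u1 := B'.1 - A'.1 in E E1 E2 *; set u2 := B'.2 - A'.2 in E E1 E2 *.
set w1 := B.1 - A.1 in E E1 E2 *; set w2 := B.2 - A.2 in E E1 E2 *.
have n0 : u1 ^+ 2 + u2 ^+ 2 != 0.
  rewrite paddr_eq0 ?sqr_ge0// !sqrf_eq0 !subr_eq0; apply/negP => /andP[/eqP h1 /eqP h2].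
  by apply: AB'; rewrite [A']surjective_pairing [B']surjective_pairing h1 h2.
(* The directions are parallel, so [(w1, w2)] is its own projection onto [(u1, u2)]; the factor is
   named [l] below. *)
have k1 : w1 = (w1 * u1 + w2 * u2) / (u1 ^+ 2 + u2 ^+ 2) * u1.
  apply: (mulIf n0); rewrite mulrAC divfK//.
  by transitivity (w1 * u1 ^+ 2 + (w1 * u2) * u2); [|rewrite E]; ring.
have k2 : w2 = (w1 * u1 + w2 * u2) / (u1 ^+ 2 + u2 ^+ 2) * u2.
  apply: (mulIf n0); rewrite mulrAC divfK//.
  by transitivity ((w2 * u1) * u1 + w2 * u2 ^+ 2); [|rewrite -E]; ring.
set l := _ / _ in k1 k2.
exists (t' + (s - t) * l); congr pair.
  rewrite (_ : A.1 = A'.1 + t' * u1 - t * w1); last by rewrite -E1; ring.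
  by rewrite k1; ring.
rewrite (_ : A.2 = A'.2 + t' * u2 - t * w2); last by rewrite -E2; ring.
by rewrite k2; ring.
Qed.

Inductive drawn_over F : set (R * R) -> Prop :=
| drawn_over_line A B : points F A -> points F B -> A <> B -> drawn_over F (line A B)
| drawn_over_circle O A : points F O -> points F A -> drawn_over F (circle O A).

Lemma drawn_over_sub F G D : F `<=` G -> drawn_over F D -> drawn_over G D.
Proof.
move=> FG [A B [] /FG ? /FG ? [] /FG ? /FG ? ?|A B [] /FG ? /FG ? [] /FG ? /FG ?].
  exact: drawn_over_line.
exact: drawn_over_circle.
Qed.

Lemma meet_line_circle F A B O Q P : subfield F ->
  points F A -> points F B -> A <> B -> points F O -> points F Q ->
  line A B P -> circle O Q P ->
  exists d, [/\ F d, 0 <= d & points (sqrt_ext F d) P].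
Proof.
move=> sF FA [FB1 FB2] AB FO FQ [t ->].
apply: (@line_circle_sqrt_ext _ _ (B.1 - A.1, B.2 - A.2)) => //.
  by case: FA => FA1 FA2; split; apply: (subfieldB sF).
rewrite -pair_eqE/= !subr_eq0; apply/negP => /andP[/eqP h1 /eqP h2].
by apply: AB; rewrite [A]surjective_pairing [B]surjective_pairing h1 h2.
Qed.

(** Subtracting the circle equations leaves the radical axis [al * x + be * y = g], a line over [F],
    so the point lies on a line and a circle. *)
Lemma meet_circles F O Q O' Q' P : subfield F ->
  points F O -> points F Q -> points F O' -> points F Q' ->
  circle O Q <> circle O' Q' -> circle O Q P -> circle O' Q' P ->
  exists d, [/\ F d, 0 <= d & points (sqrt_ext F d) P].
Proof.
move=> sF FO FQ FO' FQ' neq cP cP'.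
have OO : O <> O' by move=> OO; apply: neq; rewrite -OO in cP' *; exact: circle_eq cP cP'.
set al := O'.1 - O.1; set be := O'.2 - O.2.
set m := al ^+ 2 + be ^+ 2.
have m0 : m != 0.
  rewrite paddr_eq0 ?sqr_ge0// !sqrf_eq0 !subr_eq0; apply/negP => /andP[/eqP h1 /eqP h2].
  by apply/OO/eqP; rewrite -pair_eqE/= h1 h2 !eqxx.
pose g := ((Q.1 - O.1) ^+ 2 + (Q.2 - O.2) ^+ 2 - ((Q'.1 - O'.1) ^+ 2 + (Q'.2 - O'.2) ^+ 2)
  - O.1 ^+ 2 - O.2 ^+ 2 + O'.1 ^+ 2 + O'.2 ^+ 2) / 2.
have gE : g = al * P.1 + be * P.2.
  rewrite /g; move: cP cP'; rewrite /circle/= => <- <-.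
  by rewrite /al /be; field.
have [FO1 FO2] := FO; have [FQ1 FQ2] := FQ; have [FO1' FO2'] := FO'; have [FQ1' FQ2'] := FQ'.
have Fal : F al by in_subfield sF.
have Fbe : F be by in_subfield sF.
have Fg : F g by rewrite /g; in_subfield sF.
(* On the radical axis, [(al * g / m, be * g / m)] is the point closest to the origin and
   [(- be, al)] is the direction. *)
have [t PE] : exists t, P = (al * g / m + t * - be, be * g / m + t * al).
  exists ((al * P.2 - be * P.1) / m); rewrite [LHS]surjective_pairing gE.
  by congr pair; rewrite /m; field; exact: m0.
rewrite PE in cP *.
apply: (@line_circle_sqrt_ext F (al * g / m, be * g / m) (- be, al) O Q t) => //.
- by split => /=; rewrite /m; in_subfield sF.
- by split => /=; in_subfield sF.
rewrite -pair_eqE/= oppr_eq0; apply: contra m0 => /andP[/eqP h1 /eqP h2].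
by rewrite /m h1 h2 expr0n addr0.
Qed.

Lemma meet_lines F A B A' B' P : subfield F ->
  points F A -> points F B -> A <> B -> points F A' -> points F B' -> A' <> B' ->
  line A B <> line A' B' -> line A B P -> line A' B' P -> points F P.
Proof.
move=> sF [FA1 FA2] [FB1 FB2] AB [FA1' FA2'] [FB1' FB2'] AB' neq lP lP'.
have [E|] := eqVneq ((B.1 - A.1) * (B'.2 - A'.2)) ((B.2 - A.2) * (B'.1 - A'.1)).
  by case: neq; exact: line_eq lP lP'.
rewrite -subr_eq0 => D0; case: lP lP' => t ->[t' [E1 E2]].
(* Cramer's rule. *)
have -> : t = ((A'.1 - A.1) * (B'.2 - A'.2) - (A'.2 - A.2) * (B'.1 - A'.1)) /
    ((B.1 - A.1) * (B'.2 - A'.2) - (B.2 - A.2) * (B'.1 - A'.1)).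
  apply: (mulIf D0); rewrite divfK//.
  have -> : A'.1 - A.1 = t * (B.1 - A.1) - t' * (B'.1 - A'.1).
    by rewrite -[X in X - A.1](addrK (t' * (B'.1 - A'.1))) -E1; ring.
  have -> : A'.2 - A.2 = t * (B.2 - A.2) - t' * (B'.2 - A'.2).
    by rewrite -[X in X - A.2](addrK (t' * (B'.2 - A'.2))) -E2; ring.
  by ring.
by split=> /=; in_subfield sF.
Qed.

Lemma drawn_over_meet F D E P : subfield F -> drawn_over F D -> drawn_over F E ->
  D <> E -> D P -> E P -> exists d, [/\ F d, 0 <= d & points (sqrt_ext F d) P].
Proof.
move=> sF [A B FA FB AB|O Q FO FQ] [A' B' FA' FB' AB'|O' Q' FO' FQ'] DE DP EP.
(* Two lines meet in a point over [F] itself, which the trivial extension [d = 0] covers. *)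
- exists 0; split=> //; first exact: subfield0.
  have [P1 P2] := meet_lines sF FA FB AB FA' FB' AB' DE DP EP.
  by split; exact: sqrt_extS.
- exact: meet_line_circle DP EP.
- exact: meet_line_circle EP DP.
- exact: meet_circles DE DP EP.
Qed.

Scheme constructible_mutual := Minimality for constructible Sort Prop
  with drawn_mutual := Minimality for drawn Sort Prop.

(** Mutual induction on points and curves, each carrying a tower of its own. The towers of two
    curves are merged before they are intersected, and the intersection costs one further
    extension. *)
Lemma constructible_sqrt_tower K F (S : set (R * R)) P : subfield K ->
  sqrt_tower K F -> S `<=` points F -> constructible S P ->
  exists2 G, sqrt_tower K G & points G P.
Proof.
move=> sK tF SF.
have join G P' H Q : sqrt_tower K G -> points G P' -> sqrt_tower K H -> points H Q ->
    exists2 G', sqrt_tower K G' & points G' P' /\ points G' Q.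
  move=> tG [GP1 GP2] tH [HQ1 HQ2].
  have [G' tG' [GG' HG']] := sqrt_tower_directed sK tG tH.
  by exists G' => //; split; split; [exact: GG'|exact: GG'|exact: HG'|exact: HG'].
apply: (@constructible_mutual R S (fun P => exists2 G, sqrt_tower K G & points G P)
  (fun D => exists2 G, sqrt_tower K G & drawn_over G D)).
- by move=> Q /SF; exists F.
- move=> D E Q _ [G tG GD] _ [H tH HE] DE DQ EQ.
  have [G' tG' [GG' HG']] := sqrt_tower_directed sK tG tH.
  have sG' := sqrt_tower_subfield sK tG'.
  have [d [G'd d0 Pd]] :=
    drawn_over_meet sG' (drawn_over_sub GG' GD) (drawn_over_sub HG' HE) DE DQ EQ.
  by exists (sqrt_ext G' d) => //; exact: sqrt_tower_ext.
- move=> A B _ [G tG GA] _ [H tH HB] AB.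
  have [G' tG' [GA' GB']] := join _ _ _ _ tG GA tH HB.
  by exists G' => //; exact: drawn_over_line.
- move=> A B _ [G tG GA] _ [H tH HB] AB.
  have [G' tG' [GA' GB']] := join _ _ _ _ tG GA tH HB.
  by exists G' => //; exact: drawn_over_circle.
Qed.

Lemma Tri_cubic_root K x : subfield K -> K x -> Tri x ->
  exists2 t, K t & t ^+ 3 - 3 * t = x.
Proof.
move=> sK Kx [alpha tri xE].
have Kc : K (cos alpha).
  rewrite (_ : cos alpha = x / 2); last by rewrite xE; field.
  by in_subfield sK.
have d0 : 0 <= 1 - cos alpha ^+ 2 by rewrite -sin2cos2 sqr_ge0.
have Kd : K (1 - cos alpha ^+ 2) by in_subfield sK.
(* The square root adjoined is the absolute value of [sin alpha], so the three given points have
   coordinates in this first extension. *)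
have tF := sqrt_tower_ext (sqrt_tower_base K) Kd d0.
have sF := subfield_sqrt_ext sK Kd d0.
have [|G tG [Gc _]] := constructible_sqrt_tower sK tF _ tri.
  move=> _ [[->|->]|->]; split=> /=; try by in_subfield sF.
    exact: sqrt_extS.
  rewrite -sin2cos2 /sqrt_ext sqrtr_sqr.
  have [s0|s0] := lerP 0 (sin alpha).
    by exists 0, 1; split; [in_subfield sK..|rewrite ger0_norm//; ring].
  by exists 0, (- 1); split; [in_subfield sK..|rewrite ltr0_norm//; ring].
have sG := sqrt_tower_subfield sK tG.
apply: (cubic_root_sqrt_tower (y := 2 * cos (alpha / 3)) sK tG Kx).
  by move: Gc => /= Gc; in_subfield sG.
(* Triple angle formula, through [cos (2 u + u)] with [u = alpha / 3]. *)
rewrite xE (_ : cos alpha = cos (alpha / 3 *+ 2 + alpha / 3)); last first.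
  by congr cos; field.
rewrite cosD cos_mulr2n sin_mulr2n.
have -> : cos (alpha / 3) * sin (alpha / 3) *+ 2 * sin (alpha / 3) =
  2 * (1 - cos (alpha / 3) ^+ 2) * cos (alpha / 3) by rewrite -sin2cos2; ring.
ring.
Qed.

End QuadraticTowers.

(** * Heights *)

Section Heights.
Variables (R : realType) (K : {pred R}) (k : nat) (v : 'I_k -> R).
Hypothesis v_basis : rat_basis K v.

Lemma rat_basis_inj (q q' : 'I_k -> rat) :
  \sum_i ratr (q i) * v i = \sum_i ratr (q' i) * v i -> q =1 q'.
Proof.
case: v_basis => _ free _ E i; apply/eqP; rewrite -subr_eq0; apply/eqP; move: i.
apply: free; under eq_bigr do rewrite rmorphB mulrBl.
by rewrite sumrB E subrr.
Qed.

Lemma rat_basis_fraction (a : 'I_k -> int) (b : nat) :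
  (\sum_i (a i)%:~R * v i) / b%:R = \sum_i ratr ((a i)%:~R / b%:R) * v i.
Proof.
rewrite mulr_suml; apply: eq_bigr => i _.
rewrite rmorphM fmorphV/=. by rewrite ratr_int ratr_nat mulrAC.
Qed.

Lemma rat_basis_fraction_inj (a a' : 'I_k -> int) (b b' : nat) :
  (0 < b)%N -> (0 < b')%N ->
  (\sum_i (a i)%:~R * v i) / b%:R = (\sum_i (a' i)%:~R * v i) / b'%:R ->
  forall i, a i * b' = a' i * b.
Proof.
move=> b0 b'0; rewrite !rat_basis_fraction => /rat_basis_inj E i.
have := E i => /eqP; rewrite eqr_div ?pnatr_eq0 -?lt0n//.
by rewrite !pmulrn -!intrM eqr_int => /eqP.
Qed.

(** By [a i * b' = a' i * b], the number [b / gcd(b, b')] divides every [a i]. Being reduced forces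
    it to be 1, so [b'] is a multiple of [b] and each [a' i] is the same multiple of [a i]. *)
Lemma reduced_form_minimal (a a' : 'I_k -> int) (b b' : nat) x :
  reduced_form v x a b -> (0 < b')%N -> x = (\sum_i (a' i)%:~R * v i) / b'%:R ->
  (b <= b')%N /\ forall i, (`|a i| <= `|a' i|)%N.
Proof.
move=> [b0 red ->] b'0 /(rat_basis_fraction_inj b0 b'0) E.
have {}E i : (`|a i| * b' = `|a' i| * b)%N.
  by have /(congr1 absz) := E i; rewrite !abszM.
have [g0 gb gb'] : [/\ 0 < gcdn b b', gcdn b b' %| b & gcdn b b' %| b']%N.
  by rewrite gcdn_gt0 b0 dvdn_gcdl dvdn_gcdr.
have dvd_bb' : (b %| b')%N.
  rewrite -(divnK gb) -[X in (_ %| X)%N](divnK gb') dvdn_pmul2r//.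
  have [->//|b1] := eqVneq (b %/ gcdn b b')%N 1%N.
  case: red; exists (pdiv (b %/ gcdn b b')); split.
  - by rewrite pdiv_prime// ltn_neqAle eq_sym b1 divn_gt0// dvdn_leq.
  - exact: dvdn_trans (pdiv_dvd _) (dvdn_div gb).
  move=> i; apply: dvdn_trans (pdiv_dvd _) _.
  have cop : coprime (b %/ gcdn b b') (b' %/ gcdn b b').
    by rewrite /coprime -(eqn_pmul2r g0) muln_gcdl !divnK// mul1n.
  rewrite -(Gauss_dvdl _ cop) -(dvdn_pmul2r g0) -mulnA !divnK// E.
  exact: dvdn_mull.
have [m b'E] := dvdnP dvd_bb'.
have m0 : (0 < m)%N by move: b'0; rewrite b'E muln_gt0 => /andP[].
split=> [|i]; first exact: dvdn_leq.
have /eqP := E i; rewrite b'E mulnA eqn_pmul2r// => /eqP <-.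
by rewrite leq_pmulr.
Qed.

(** A reduced fraction has the least numerators and denominator, so any fraction for [x] with
    entries at most [r] bounds the height. This frees the counting from reduced forms. *)
Lemma height_ballP r x : divring_closed K ->
  height_ball K v r x <->
  exists a b, [/\ (0 < b)%N, x = (\sum_i (a i)%:~R * v i) / b%:R,
    b%:R <= r & forall i, `|a i|%N%:R <= r].
Proof.
move=> Kfield.
have ht y : y \in K -> exists a b, reduced_form v y a b /\
    height v y = maxn (\max_(i < k) `|a i|%N) b.
  move=> yK; have [a [b red]] := reduced_form_exists v_basis yK.
  have /(xgetPex 0%N) : exists h, [set h | exists a b,
      reduced_form v y a b /\ h = maxn (\max_(i < k) `|a i|%N) b] h.
    by exists (maxn (\max_(i < k) `|a i|%N) b); exists a, b.
  by [].
split=> [[xK hx]|[a [b [b0 xE br ar]]]].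
  have [a [b [[b0 _ xE] hE]]] := ht _ xK; exists a, b.
  split=> //; first by apply: le_trans hx; rewrite ler_nat hE leq_maxr.
  move=> i; apply: le_trans hx; rewrite ler_nat hE.
  by apply: leq_trans (leq_maxl _ _); exact: leq_bigmax.
have r0 : 0 <= r by exact: le_trans br.
have xK : x \in K.
  have [vK _ _] := v_basis.
  have sK : subfield [set` K] by case: Kfield.
  have Kint n : [set` K] (n%:~R : R).
    by case: n => n; rewrite ?NegzE ?mulrNz; [|apply: subfieldN => //]; exact: subfield_nat.
  rewrite xE; apply: (subfieldM sK); last by apply/(subfieldV sK)/(subfield_nat sK).
  elim/big_ind: _ => [|y z|i _]; [exact: (subfield0 sK)|exact: (subfieldD sK)|].
  by apply: (subfieldM sK) => //; exact: vK.
split=> //.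
have [a' [b' [red ->]]] := ht _ xK.
have [bb' aa'] := reduced_form_minimal red b0 xE.
have [n nr rn] : exists2 n : nat, n%:R <= r & forall m : nat, m%:R <= r -> (m <= n)%N.
  exists (Num.truncn r); first by rewrite truncn_le.
  by move=> m mr; rewrite truncn_ge_nat.
apply: le_trans nr; rewrite ler_nat geq_max; apply/andP; split;
  last exact: leq_trans bb' (rn _ br).
by apply/bigmax_leqP => i _; rewrite (leq_trans (aa' i))// rn.
Qed.

End Heights.

(** * Counting points of bounded height *)

Section Counting.
Variable R : realType.

Lemma leq_card_ncard (T : finType) (f : T -> R) (A : set R) :
  finite_set A -> injective f -> range f `<=` A -> (#|T| <= ncard A)%N.
Proof.
move=> finA f_inj fA; rewrite cardE -(size_map f); apply: uniq_leq_size.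
  by rewrite map_inj_uniq ?enum_uniq.
by move=> _ /mapP[t _ ->]; rewrite in_fset_set// inE; apply: fA; exists t.
Qed.

Lemma ncard_leq_card (T : finType) (f : T -> R) (A : set R) :
  A `<=` range f -> (ncard A <= #|T|)%N.
Proof.
move=> Af; have finA : finite_set A.
  by apply: sub_finite_set Af _; apply: finite_image; exact: finite_finset.
rewrite cardE -(size_map f); apply: uniq_leq_size; first exact: fset_uniq.
move=> x; rewrite in_fset_set// inE => /Af[t _ <-].
by apply: map_f; rewrite mem_enum.
Qed.

(** Compare 2-adic valuations. This separates the fractions of the next count. *)
Lemma expn2_odd_inj i j b c : odd b -> odd c -> (2 ^ i * b = 2 ^ j * c)%N ->
  i = j /\ b = c.
Proof.
move=> ob oc E.
have lg h d : odd d -> logn 2 (2 ^ h * d) = h.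
  move=> od; have d0 : (0 < d)%N by case: d od.
  by rewrite lognM ?expn_gt0// pfactorK// logn_coprime ?coprime2n// addn0.
have ij : i = j by rewrite -(lg i b ob) E lg.
by split=> //; apply/eqP; rewrite -(@eqn_pmul2l (2 ^ i)) ?expn_gt0// E ij.
Qed.

(** The numerators are [2 ^ i] with [i < L] on the first basis vector and numbers below [m] on the
    others; the denominators are [m] odd numbers from [2 * V * m + 1] on. The condition on [r]
    ensures [2 ^ L <= m], which keeps all numerators at most [m]. *)
Lemma height_ball_card_ge (K : {pred R}) k (v : 'I_k.+1 -> R) :
  divring_closed K -> rat_basis K v ->
  exists2 W : nat, (0 < W)%N & forall (L : nat) (r : R), (W * 2 ^ L)%N%:R <= r ->
    exists m : nat, [/\ (0 < m)%N, r <= (W * m)%N%:R &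
      (L * m ^ k.+1 <= ncard (height_ball K v r `&` `[(- 2)%R, 2%R]))%N].
Proof.
move=> Kfield v_basis.
have [V sV] : exists V : nat, \sum_j `|v j| <= V%:R.
  by exists (Num.truncn (\sum_j `|v j|)).+1; apply/ltW/truncnS_gt.
(* The denominators will be at most [U * m], with [m] the integer part of [r / U]; the factor 2
   comes from [r < U * (m + 1) <= 2 * U * m]. *)
pose U := (V.*2 + 3)%N; exists (2 * U)%N; first by rewrite /U; lia.
move=> L r Wr.
have U0 : 0 < U%:R :> R by rewrite ltr0n /U; lia.
have rU0 : 0 <= r / U%:R by rewrite divr_ge0 ?ler0n// (le_trans _ Wr).
pose m := Num.truncn (r / U%:R).
have Lm : (2 ^ L <= m)%N.
  rewrite truncn_ge_nat// ler_pdivlMr// -natrM (le_trans _ Wr)// ler_nat; lia.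
have mr : (U * m)%N%:R <= r.
  by rewrite natrM mulrC -ler_pdivlMr// truncn_le.
have rm : r < (U * m.+1)%N%:R.
  by rewrite natrM mulrC -ltr_pdivrMr// truncnS_gt.
have m0 : (0 < m)%N by apply: leq_trans Lm; rewrite expn_gt0.
exists m; split=> //.
  by apply/ltW/(lt_le_trans rm); rewrite ler_nat; nia.
pose T : finType := ('I_L * {ffun 'I_k -> 'I_m} * 'I_m)%type.
have -> : (L * m ^ k.+1 = #|{: T}|)%N.
  by rewrite !card_prod card_ffun !card_ord expnSr mulnA.
pose a (u : T) (j : 'I_k.+1) : nat :=
  if unlift ord0 j is Some j' then u.1.2 j' else (2 ^ u.1.1)%N.
pose b (u : T) : nat := (V * m + u.2).*2.+1.
have am u j : (a u j <= m)%N.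
  rewrite /a; case: unliftP => [j' _|_]; first exact: ltnW.
  by apply: leq_trans Lm; rewrite leq_exp2l// ltnW.
have bU u : (b u <= U * m)%N by rewrite /b /U; have := ltn_ord u.2; nia.
apply: (@leq_card_ncard _ (fun u => (\sum_j (a u j)%:Z%:~R * v j) / (b u)%:R)).
- exact/finite_setIl/finite_height_ball.
- move=> u u' /(rat_basis_fraction_inj v_basis) E.
  have {}E j : (a u j * b u' = a u' j * b u)%N by have [] := E isT isT j.
  (* On the first coordinate both sides are a power of 2 times an odd denominator, so exponents and
     denominators agree; the other numerators follow. *)
  have := E ord0; rewrite /a unlift_none => /expn2_odd_inj[]; rewrite ?/b/= ?odd_double//.
  move=> e1 e2.
  have e3 : u.2 = u'.2 by apply: val_inj => /=; lia.
  have e4 : u.1.2 = u'.1.2.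
    apply/ffunP => j; apply: val_inj => /=.
    have := E (lift ord0 j); rewrite /a liftK /b e3 => /eqP.
    by rewrite eqn_pmul2r// => /eqP.
  move: e1 e3 e4; case: u u' {E e2} => [[i g] be] [[i' g'] be'] /= e1 -> ->.
  by have -> : i = i' by exact: val_inj.
move=> _ [u _ <-]; split.
  apply/(height_ballP v_basis _ _ Kfield); exists (fun j => (a u j)%:Z), (b u); split=> //.
    by apply: le_trans mr; rewrite ler_nat.
  by move=> j; apply: le_trans mr; rewrite ler_nat (leq_trans (am u j))// leq_pmull// /U; lia.
(* The sum is at most [m * V] in absolute value, which is less than [b u]. *)
rewrite /= in_itv/= -ler_norml normrM normfV [X in _ / X]ger0_norm ?ler0n//.
rewrite ler_pdivrMr ?ltr0n//.
have : `|\sum_j (a u j)%:Z%:~R * v j| <= m%:R * V%:R.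
  apply: le_trans (ler_norm_sum _ _ _) _.
  apply: (@le_trans _ _ (m%:R * \sum_j `|v j|)); last by rewrite ler_wpM2l.
  rewrite mulr_sumr; apply: ler_sum => j _; rewrite normrM ler_wpM2r//.
  by rewrite ger0_norm ?ler0n// ler_nat.
move=> H; apply: le_trans H _; rewrite -!natrM ler_nat /b; nia.
Qed.

End Counting.

(** * Elements of the form t^3 - 3 t *)

Section PrimitiveQuadratics.

Definition primitive3 (c0 c1 c2 : int) :=
  forall p : nat, prime p -> (p %| c0)%Z -> (p %| c1)%Z -> (p %| c2)%Z -> False.

(** [s] and [n] stand for the sum and the product of the roots of [c0 X^2 - c1 X + c2]. Here [c0] is
    the least common denominator: a common prime factor could be divided out of it. *)
Lemma primitive_multiple (s n : rat) : exists (c0 : nat) (c1 c2 : int),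
  [/\ (0 < c0)%N, c1%:~R = c0%:R * s, c2%:~R = c0%:R * n & primitive3 c0 c1 c2].
Proof.
have den (q : rat) : (`|denq q|%N)%:R * q \is a Num.int.
  by rewrite [_%:R]pmulrn absz_denq mulrC -numqE rpred_int.
have ex : exists c, [&& (0 < c)%N, c%:R * s \is a Num.int & c%:R * n \is a Num.int].
  exists (`|denq s| * `|denq n|)%N; rewrite muln_gt0 !absz_gt0 !denq_neq0 !natrM/=.
  by rewrite mulrAC rpredM ?den ?rpred_nat// -mulrA rpredM ?den ?rpred_nat.
case: (ex_minnP ex) => c /and3P[c0 /intrP[c1 E1] /intrP[c2 E2]] cmin.
exists c, c1, c2; split=> // p pp.
rewrite dvdzE/= => pc /dvdzP[e1 e1E] /dvdzP[e2 e2E].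
have p0 : (p%:R : rat) != 0 by rewrite pnatr_eq0 -lt0n prime_gt0.
have : (c <= c %/ p)%N; last by rewrite leqNgt ltn_Pdiv// prime_gt1.
have quo (q : rat) (e : int) : c%:R * q = (e * p%:Z)%:~R -> (c %/ p)%:R * q \is a Num.int.
  move=> E; suff -> : (c %/ p)%:R * q = e%:~R by exact: rpred_int.
  by apply: (mulIf p0); rewrite mulrAC -natrM divnK// E intrM -pmulrn.
apply: cmin; rewrite divn_gt0 ?prime_gt0// dvdn_leq//=.
by rewrite (quo s e1) ?(quo n e2)// ?E1 ?E2 ?e1E ?e2E.
Qed.

(* If c0 X^2 - c1 X + c2 has roots t and t', then c0^3 X^2 - c1' X + c2' has
   roots t^3 - 3 t and t'^3 - 3 t', where c1' and c2' are the two integers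
   below; it is again primitive. *)
Definition cubic_trace (c0 c1 c2 : int) : int :=
  c1 ^+ 3 - 3 * c0 * c1 * c2 - 3 * c0 ^+ 2 * c1.
Definition cubic_norm (c0 c1 c2 : int) : int :=
  c2 * (c2 ^+ 2 - 3 * c1 ^+ 2 + 6 * c0 * c2 + 9 * c0 ^+ 2).

Lemma cubic_traceE (F : comNzRingType) c0 c1 c2 : (cubic_trace c0 c1 c2)%:~R =
  c1%:~R ^+ 3 - 3 * c0%:~R * c1%:~R * c2%:~R - 3 * c0%:~R ^+ 2 * c1%:~R :> F.
Proof. by rewrite /cubic_trace; ring. Qed.

Lemma cubic_normE (F : comNzRingType) c0 c1 c2 : (cubic_norm c0 c1 c2)%:~R =
  c2%:~R * (c2%:~R ^+ 2 - 3 * c1%:~R ^+ 2 + 6 * c0%:~R * c2%:~R + 9 * c0%:~R ^+ 2) :> F.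
Proof. by rewrite /cubic_norm; ring. Qed.

(** Modulo a prime dividing [c0] the trace is [c1 ^+ 3]; if the prime also divides [c1], the norm is
    [c2 ^+ 3] modulo it. *)
Lemma cubic_primitive3 c0 c1 c2 : primitive3 c0 c1 c2 ->
  primitive3 (c0 ^+ 3) (cubic_trace c0 c1 c2) (cubic_norm c0 c1 c2).
Proof.
move=> prim p pp.
have cube c : (p %| c ^+ 3)%Z -> (p %| c)%Z by rewrite !dvdzE abszX/= Euclid_dvdX// => /andP[].
move=> /cube p0 p1 p2.
have {}p1 : (p %| c1)%Z.
  apply: cube; have -> : c1 ^+ 3 = cubic_trace c0 c1 c2 + c0 * (3 * c1 * c2 + 3 * c0 * c1).
    by rewrite /cubic_trace; ring.
  by rewrite rpredD// dvdz_mulr.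
apply: (prim p pp p0 p1); apply: cube.
have -> : c2 ^+ 3 = cubic_norm c0 c1 c2 -
  (c0 * (6 * c2 ^+ 2 + 9 * c0 * c2) + c1 * (- 3 * c1 * c2)).
  by rewrite /cubic_norm; ring.
by rewrite rpredB// rpredD// dvdz_mulr.
Qed.

(** The equations say that [n] clears the denominators of the monic polynomial obtained on division
    by [c0 ^+ 3]. So [c0 ^ 3] divides [n] times each coefficient of a primitive polynomial, hence
    [n]. *)
Lemma primitive_cube_dvd (c0 n : nat) (c1 c2 m1 m2 : int) :
  (0 < c0)%N -> primitive3 c0 c1 c2 ->
  c0%:Z ^+ 3 * m1 = n%:Z * cubic_trace c0 c1 c2 ->
  c0%:Z ^+ 3 * m2 = n%:Z * cubic_norm c0 c1 c2 -> (c0 ^ 3 %| n)%N.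
Proof.
move=> c00 /cubic_primitive3 prim E1 E2.
set q1 := cubic_trace _ _ _ in prim E1; set q2 := cubic_norm _ _ _ in prim E2.
have g1 : gcdn (c0 ^ 3) (gcdn `|q1| `|q2|) = 1%N.
  set g := gcdn _ _; apply/eqP/negPn/negP => g1.
  have g0 : (0 < g)%N by rewrite gcdn_gt0 expn_gt0 c00.
  have pg : (pdiv g %| g)%N := pdiv_dvd g.
  apply: (prim (pdiv g)); first by rewrite pdiv_prime// ltn_neqAle eq_sym g1.
  - by rewrite dvdzE abszX/= (dvdn_trans pg)// dvdn_gcdl.
  - by rewrite dvdzE/= (dvdn_trans pg)// (dvdn_trans (dvdn_gcdr _ _))// dvdn_gcdl.
  - by rewrite dvdzE/= (dvdn_trans pg)// (dvdn_trans (dvdn_gcdr _ _))// dvdn_gcdr.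
rewrite -[n]muln1 -[X in (_ %| _ * X)%N]g1 !muln_gcdr !dvdn_gcd dvdn_mull//=.
have dvd q m : c0%:Z ^+ 3 * m = n%:Z * q -> (c0 ^ 3 %| n * `|q|)%N.
  by move=> E; rewrite -[n]/(`|n%:Z|%N) -abszM -E abszM abszX dvdn_mulr.
by rewrite (dvd _ _ E1) (dvd _ _ E2).
Qed.

End PrimitiveQuadratics.

(** * Size of the quadratic polynomials that vanish at t *)

Section CubicImage.
Variable R : realType.
Implicit Types (K : {pred R}).

Let ratrD x y : ratr (x + y) = ratr x + ratr y :> R. Proof. exact: rmorphD. Qed.
Let ratrN x : ratr (- x) = - ratr x :> R. Proof. exact: rmorphN. Qed.
Let ratrM x y : ratr (x * y) = ratr x * ratr y :> R. Proof. exact: rmorphM. Qed.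
Let ratrX x n : ratr (x ^+ n) = ratr x ^+ n :> R. Proof. exact: rmorphXn. Qed.
Let ratrV x : ratr x^-1 = (ratr x)^-1 :> R. Proof. exact: fmorphV. Qed.
Let ratrE := (ratr_nat, ratr_int, ratrX, ratrV, ratrD, ratrN, ratrM).

(** Beyond 3 in absolute value, [t ^+ 2 - 3] exceeds two thirds of [t ^+ 2]; up to 3, the cube is at
    most 27. *)
Lemma cubic_growth (t : R) : `|t| ^+ 3 <= 27 + 2 * `|t ^+ 3 - 3 * t|.
Proof.
have -> : t ^+ 3 - 3 * t = t * (t ^+ 2 - 3) by ring.
have [t3|t3] := lerP `|t| 3.
  have := normr_ge0 (t * (t ^+ 2 - 3)); have := normr_ge0 t; nra.
rewrite normrM -(real_normK (num_real t)); move: `|t| t3 => z z3.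
by rewrite ger0_norm; nra.
Qed.

(** [t] is treated as a root of [X (c0 X - c1)]: the second root 0, which [X^3 - 3 X] maps to 0,
    takes the place of a conjugate. *)
Lemma rational_quadratic_root K (v : 'I_1 -> R) :
  divring_closed K -> rat_basis K v -> exists2 C : R, 1 <= C &
  forall r x t, 1 <= r -> height_ball K v r x -> `|x| <= 2 -> t \in K ->
    t ^+ 3 - 3 * t = x -> exists c : int * int * int,
    [/\ c.1.1 != 0, c.1.1%:~R * t ^+ 2 + c.1.2%:~R * t + c.2%:~R = 0,
        `|c.1.1|%N%:R ^+ 3 <= C * r, `|c.1.2|%N%:R ^+ 3 <= C * r
      & `|c.2|%N%:R ^+ 3 <= C * r].
Proof.
move=> Kfield vB; have [K1 _ _] := Kfield; have [vK _ span] := vB.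
have [w vE] : exists w : rat, v ord0 = ratr w.
  have [q] := span _ K1; rewrite big_ord1 => qv; exists (q ord0)^-1.
  have q0 : ratr (q ord0) != 0 :> R by apply: contra_eq_neq qv => ->; rewrite mul0r oner_eq0.
  by rewrite fmorphV; apply: (mulfI q0); rewrite -qv divff.
pose D := `|denq w|%N; have D0 : (0 < D)%N by rewrite absz_gt0 denq_neq0.
have D0R : D%:R != 0 :> R by rewrite pnatr_eq0 -lt0n.
have wE : v ord0 = (numq w)%:~R / D%:R by rewrite vE /ratr [D%:R]pmulrn absz_denq.
have D1 : 1 <= D%:R :> R by rewrite ler1n.
exists (31 * D%:R); first by lra.
move=> r x t r1 /(height_ballP vB _ _ Kfield)[a [b [b0 xE br _]]] x2 tK tx.
have [q] := span _ tK; rewrite big_ord1 vE -rmorphM; move: (_ * _) => tau tE.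
have [c0 [c1 [c2 [c00 c1E c2E prim]]]] := primitive_multiple tau 0.
have {}c2E : c2 = 0 by move/eqP: c2E; rewrite mulr0 intr_eq0 => /eqP.
have {}c1E : c1%:~R = c0%:R * t.
  by rewrite tE -(ratr_int R) c1E !ratrE.
have b0R : b%:R != 0 :> R by rewrite pnatr_eq0 -lt0n.
have cub : (c0 ^ 3 %| b * D)%N.
  apply: (@primitive_cube_dvd _ _ c1 c2 (a ord0 * numq w) 0) => //; last first.
    by rewrite /cubic_norm c2E mul0r !mulr0.
  apply: (@intr_inj R); rewrite /cubic_trace c2E !mulr0 subr0.
  rewrite !(rmorphM, rmorphB, rmorphXn)/= c1E -!pmulrn.
  rewrite (_ : (a ord0)%:~R * _ = b%:R * D%:R * (t ^+ 3 - 3 * t)); first by ring.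
  rewrite tx xE big_ord1 wE; field; by rewrite b0R.
have c0r : c0%:R ^+ 3 <= D%:R * r.
  rewrite -natrX; apply: (@le_trans _ _ (b * D)%:R).
    by rewrite ler_nat dvdn_leq// muln_gt0 b0.
  by rewrite natrM mulrC ler_wpM2l.
have Dr : 0 <= D%:R * r by rewrite mulr_ge0// (le_trans _ r1).
(* 31 is [27 + 2 * 2], as [x] is at most 2 in absolute value. *)
have t31 : `|t| ^+ 3 <= 31 by have := cubic_growth t; rewrite tx; lra.
exists (c0%:Z, - c1, 0); split=> /=.
- by rewrite -lt0n.
- by rewrite -pmulrn mulrNz c1E; ring.
- by rewrite -mulrA; lra.
- rewrite abszN natr_absz intr_norm c1E normrM exprMn ger0_norm ?ler0n//.
  by rewrite -mulrA mulrC ler_pM// exprn_ge0// ler0n.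
- by rewrite expr0n/= -mulrA; lra.
Qed.

(** In these coordinates conjugation is the change of sign of [theta], and [E] is a common
    denominator for the basis. *)
Lemma quadratic_field_coordinates K (v : 'I_2 -> R) :
  divring_closed K -> rat_basis K v ->
  exists (theta : R) (d : int) (E : nat) (p q : 'I_2 -> int),
  [/\ theta ^+ 2 = d%:~R,
      forall r s : rat, ratr r + ratr s * theta = 0 -> r = 0 /\ s = 0,
      (0 < E)%N,
      forall i, v i = ((p i)%:~R + (q i)%:~R * theta) / E%:R
    & forall t, t \in K -> exists r s : rat, t = ratr r + ratr s * theta].
Proof.
move=> Kfield vB; have [K1 _ _] := Kfield; have [vK free span] := vB.
have sK : subfield [set` K] by case: Kfield.
have [al al1] := span _ K1.
(* Some coordinate of 1 is nonzero, so 1 can replace that basis vector; [w] is the other one. *)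
have [w [wK wspan wfree]] : exists w, [/\ w \in K,
    forall t, t \in K -> exists r s : rat, t = ratr r + ratr s * w
  & forall r s : rat, ratr r + ratr s * w = 0 -> r = 0 /\ s = 0].
  have [i ali] : exists i, al i != 0.
    apply/existsP; rewrite -negb_forall; apply: contra_eqN al1 => /forallP al0.
    by rewrite big1 ?oner_eq0// => j _; rewrite (eqP (al0 j)) rmorph0 mul0r.
  pose j := lift i (ord0 : 'I_1).
  have sum2 (F : 'I_2 -> R) : \sum_l F l = F i + F j.
    by rewrite (bigD1_ord i)//= big_ord1.
  have ij : j != i by rewrite eq_sym neq_lift.
  have ai : ratr (al i) != 0 :> R by rewrite fmorph_eq0.
  move: al1; rewrite sum2 => al1.
  exists (v j); split=> // [t /span[q ->]|r s E].
    exists (q i / al i), (q j - q i / al i * al j).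
    rewrite sum2 !ratrE.
    transitivity (ratr (q i) / ratr (al i) * 1 +
      (ratr (q j) - ratr (q i) / ratr (al i) * ratr (al j)) * v j); last by rewrite mulr1.
    by rewrite al1; field.
  have := free (fun l => if l == i then r * al i else r * al j + s).
  rewrite sum2 eqxx (negbTE ij) !ratrE.
  have -> : ratr r * ratr (al i) * v i + (ratr r * ratr (al j) + ratr s) * v j = 0.
    by rewrite -E -[in RHS](mulr1 (ratr r)) al1; ring.
  move=> /(_ erefl) z; have /eqP := z i; rewrite eqxx mulf_eq0 (negbTE ali) orbF => /eqP r0.
  by have := z j; rewrite (negbTE ij) r0 mul0r add0r.
have [p [q w2]] := wspan _ (subfieldM sK wK wK).
(* Completing the square in [w^2 = p + q w] gives [(w - q / 2)^2 = delta]; scaling by the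
   denominator of [delta] makes the square an integer. *)
pose delta := p + q ^+ 2 / 4; pose n : R := (denq delta)%:~R.
have n0 : denq delta != 0 by rewrite denq_neq0.
have n0R : n != 0 by rewrite intr_eq0.
pose theta := n * (w - ratr q / 2).
have thetaE : theta ^+ 2 = (numq delta * denq delta)%:~R.
  have -> : theta ^+ 2 = n ^+ 2 * ratr delta.
    rewrite /theta /delta exprMn; congr (_ * _).
    rewrite !ratrE.
    by rewrite sqrrB expr2 w2; field.
  by rewrite /ratr intrM -/n; field.
have wE : w = ratr (q / 2) + ratr (denq delta)%:~R^-1 * theta.
  rewrite !ratrE -/n /theta; field.
  by rewrite n0R.
have span' t : t \in K -> exists r s : rat, t = ratr r + ratr s * theta.
  move=> /wspan[r [s ->]]; exists (r + s * (q / 2)), (s * (denq delta)%:~R^-1).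
  by rewrite {1}wE !ratrE; ring.
have free' r s : ratr r + ratr s * theta = 0 -> r = 0 /\ s = 0.
  move=> E; have := wfree (r - s * (denq delta)%:~R * q / 2) (s * (denq delta)%:~R).
  rewrite !ratrE -/n.
  have -> : ratr r - ratr s * n * ratr q / 2 + ratr s * n * w = 0.
    by rewrite -E /theta; field.
  move=> /(_ erefl)[r0 /eqP]; rewrite mulf_eq0 intr_eq0 (negbTE n0) orbF => /eqP s0.
  by move: r0; rewrite s0 !mul0r subr0.
have /choice[f fE] i : exists f : rat * rat, v i = ratr f.1 + ratr f.2 * theta.
  by have [r [s rs]] := span' _ (vK i); exists (r, s).
pose E := \prod_i (`|denq (f i).1| * `|denq (f i).2|)%N.
have E0 : (0 < E)%N by rewrite prodn_gt0// => i; rewrite muln_gt0 !absz_gt0 !denq_neq0.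
have clear (x : rat) : (`|denq x| %| E)%N -> exists m : int, ratr x = m%:~R / E%:R :> R.
  move=> /dvdnP[m mE]; exists (m%:Z * numq x).
  have dR : `|denq x|%N%:R = (denq x)%:~R :> R by rewrite pmulrn absz_denq.
  rewrite mE intrM natrM dR /ratr -[m%:~R]pmulrn; field.
  rewrite intr_eq0 denq_neq0 pnatr_eq0 -lt0n.
  by move: E0; rewrite mE muln_gt0 => /andP[].
have dE i : (`|denq (f i).1| %| E)%N /\ (`|denq (f i).2| %| E)%N.
  by rewrite /E (bigD1 i)//=; split; apply: dvdn_mulr;
    [exact: dvdn_mulr _ (dvdnn _)|exact: dvdn_mull _ (dvdnn _)].
have /choice[p' p'E] i := clear _ (dE i).1.
have /choice[q' q'E] i := clear _ (dE i).2.
exists theta, (numq delta * denq delta), E, p', q'; split=> // i.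
by rewrite fE p'E q'E; ring.
Qed.

(** Let [t'] be the conjugate of [t], and [x = (P + Q th) / u] with [u = E * b]. Then [u ^ 2] clears
    the denominators of the trace and norm of [x], so [c0 ^ 3] divides [u ^ 2], which is at most
    [(E * r)^2]. The conjugate of [x] is at most [V * r / u] in absolute value, and [cubic_growth]
    turns this into a bound for [t']. *)
Lemma quadratic_quadratic_root K (v : 'I_2 -> R) :
  divring_closed K -> rat_basis K v -> exists2 C : R, 1 <= C &
  forall r x t, 1 <= r -> height_ball K v r x -> `|x| <= 2 -> t \in K ->
    t ^+ 3 - 3 * t = x -> exists c : int * int * int,
    [/\ c.1.1 != 0, c.1.1%:~R * t ^+ 2 + c.1.2%:~R * t + c.2%:~R = 0,
        `|c.1.1|%N%:R ^+ 3 <= C * r ^+ 2, `|c.1.2|%N%:R ^+ 3 <= C * r ^+ 2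
      & `|c.2|%N%:R ^+ 3 <= C * r ^+ 2].
Proof.
move=> Kfield vB.
have [th [d [E [p [q [th2 free E0 vE span]]]]]] := quadratic_field_coordinates Kfield vB.
pose V : R := \sum_i `|(p i)%:~R - (q i)%:~R * th|.
have V0 : 0 <= V by apply: sumr_ge0.
have E1 : 1 <= E%:R :> R by rewrite ler1n.
(* Chosen so that [B * r ^+ 2] bounds [c0 ^+ 3] times 31 and [c0 ^+ 3] times the cube of the
   absolute value of [t']. *)
pose B : R := 31 * E%:R ^+ 2 + 2 * E%:R * V.
have B1 : 31 <= B by rewrite /B; nra.
(* Covers [8 * B], which [c1] requires, and [31 * B], which [c2] requires. *)
exists (4 * (31 * B)); first by lra.
move=> r x t r1 /(height_ballP vB _ _ Kfield)[a [b [b0 xE br ar]]] x2 /span[s1 [s2 tE]] tx.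
pose u := (E * b)%N; have u0 : (0 < u)%N by rewrite muln_gt0 E0.
pose P := \sum_i a i * p i; pose Q := \sum_i a i * q i.
have castR (n : 'I_2 -> int) : (\sum_i a i * n i)%:~R = \sum_i (a i)%:~R * (n i)%:~R :> R.
  by rewrite rmorph_sum/=; apply: eq_bigr => i _; rewrite intrM.
have b0R : b%:R != 0 :> R by rewrite pnatr_eq0 -lt0n.
have E0R : E%:R != 0 :> R by rewrite pnatr_eq0 -lt0n.
have u0R : u%:R != 0 :> R by rewrite pnatr_eq0 -lt0n.
have xPQ : x = (P%:~R + Q%:~R * th) / u%:R.
  rewrite xE /P /Q !castR [_ * th]mulr_suml -big_split/= natrM invfM mulrA; congr (_ / _).
  by rewrite mulr_suml; apply: eq_bigr => i _; rewrite vE; field.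
(* [X] and [Y] are the coordinates of [t ^+ 3 - 3 * t] on 1 and [th]. *)
pose X := s1 ^+ 3 + 3 * s1 * s2 ^+ 2 * d%:~R - 3 * s1.
pose Y := 3 * s1 ^+ 2 * s2 + s2 ^+ 3 * d%:~R - 3 * s2.
have XR : ratr X = ratr s1 ^+ 3 + 3 * ratr s1 * ratr s2 ^+ 2 * th ^+ 2 - 3 * ratr s1 :> R.
  by rewrite th2 /X !ratrE.
have YR : ratr Y = 3 * ratr s1 ^+ 2 * ratr s2 + ratr s2 ^+ 3 * th ^+ 2 - 3 * ratr s2 :> R.
  by rewrite th2 /Y !ratrE.
have [PX QY] : P%:~R = u%:R * X /\ Q%:~R = u%:R * Y.
  have [] := free (P%:~R - u%:R * X) (Q%:~R - u%:R * Y); last first.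
    by move=> /subr0_eq + /subr0_eq.
  rewrite !ratrE.
  transitivity (u%:R * (x - (ratr X + ratr Y * th))); first by rewrite xPQ XR YR th2; field.
  by rewrite -tx tE XR YR; ring.
have [c0 [c1 [c2 [c00 c1E c2E prim]]]] :=
  primitive_multiple (2 * s1) (s1 ^+ 2 - s2 ^+ 2 * d%:~R).
have u2E : (u ^ 2)%N%:Z = u%:Z ^+ 2 by rewrite expnS expn1 PoszM expr2.
have cub : (c0 ^ 3 %| u ^ 2)%N.
  (* The two integers supplied are [u ^+ 2] times the trace and the norm of [x]. *)
  apply: (@primitive_cube_dvd _ _ c1 c2 (2 * P * u%:Z) (P ^+ 2 - d * Q ^+ 2)) => //.
    apply: (@intr_inj rat).
    transitivity (c0%:R ^+ 3 * (2 * P%:~R * u%:R) : rat); first by ring.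
    transitivity (u%:R ^+ 2 * (cubic_trace c0 c1 c2)%:~R : rat); last by rewrite u2E; ring.
    by rewrite cubic_traceE c1E c2E PX /X; ring.
  apply: (@intr_inj rat).
  transitivity (c0%:R ^+ 3 * (P%:~R ^+ 2 - d%:~R * Q%:~R ^+ 2) : rat); first by ring.
  transitivity (u%:R ^+ 2 * (cubic_norm c0 c1 c2)%:~R : rat); last by rewrite u2E; ring.
  by rewrite cubic_normE c1E c2E PX QY /X /Y; ring.
pose t' := ratr s1 - ratr s2 * th.
have {}c1E : c1%:~R = c0%:R * (t + t').
  by rewrite -(ratr_int R) c1E !ratrE tE /t'; ring.
have {}c2E : c2%:~R = c0%:R * (t * t').
  by rewrite -(ratr_int R) c2E !ratrE -th2 tE /t'; ring.
have t'x : u%:R * (t' ^+ 3 - 3 * t') = P%:~R - Q%:~R * th.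
  rewrite -(ratr_int R P) -(ratr_int R Q) PX QY 2!ratrM ratr_nat XR YR /t'; ring.
have PQ : `|P%:~R - Q%:~R * th| <= V * r.
  rewrite !castR mulr_suml -sumrB; apply: le_trans (ler_norm_sum _ _ _) _.
  rewrite mulr_suml; apply: ler_sum => i _.
  rewrite -mulrA -mulrBr normrM mulrC ler_wpM2l//.
  by have := ar i; rewrite natr_absz intr_norm.
have c0u : c0%:R ^+ 3 <= u%:R ^+ 2 :> R.
  by rewrite -!natrX ler_nat dvdn_leq// expn_gt0 u0.
have ur : u%:R <= E%:R * r by rewrite natrM ler_wpM2l// ler0n.
have u0' : 0 <= u%:R :> R by rewrite ler0n.
have c0' : 0 <= c0%:R ^+ 3 :> R by rewrite exprn_ge0// ler0n.
have u2 : u%:R ^+ 2 <= E%:R ^+ 2 * r ^+ 2 by rewrite -exprMn ler_sqr// nnegrE; nra.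
have ct' : c0%:R ^+ 3 * `|t'| ^+ 3 <= B * r ^+ 2.
  have g := cubic_growth t'.
  have g1 : u%:R * `|t' ^+ 3 - 3 * t'| <= V * r.
    by rewrite -[u%:R]ger0_norm// -normrM t'x.
  have g2 : u%:R ^+ 2 * `|t' ^+ 3 - 3 * t'| <= E%:R * V * r ^+ 2.
    rewrite expr2 -mulrA (_ : _ * r ^+ 2 = (E%:R * r) * (V * r)); last by ring.
    by rewrite ler_pM// mulr_ge0.
  apply: le_trans (ler_wpM2l c0' g) _.
  apply: (@le_trans _ _ (u%:R ^+ 2 * (27 + 2 * `|t' ^+ 3 - 3 * t'|))).
    by rewrite ler_wpM2r// addr_ge0// mulr_ge0.
  have := sqr_ge0 u%:R; rewrite /B; lra.
have t31 : `|t| ^+ 3 <= 31 by have := cubic_growth t; rewrite tx; lra.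
have Br : 0 <= B * r ^+ 2 by rewrite mulr_ge0 ?sqr_ge0//; lra.
have c0B : c0%:R ^+ 3 * 31 <= B * r ^+ 2.
  have : 0 <= E%:R * V * r ^+ 2 by rewrite mulr_ge0 ?sqr_ge0// mulr_ge0// ler0n.
  rewrite /B; lra.
have ct : c0%:R ^+ 3 * `|t| ^+ 3 <= B * r ^+ 2.
  by apply: le_trans c0B; rewrite ler_wpM2l.
exists (c0%:Z, - c1, c2); split=> /=.
- by rewrite -lt0n.
- by rewrite -pmulrn mulrNz c1E c2E; ring.
- lra.
- rewrite abszN natr_absz intr_norm c1E normrM normr_nat exprMn.
  apply: (@le_trans _ _ (c0%:R ^+ 3 * (4 * (`|t| ^+ 3 + `|t'| ^+ 3)))); last by lra.
  rewrite ler_wpM2l//; apply: (@le_trans _ _ ((`|t| + `|t'|) ^+ 3)).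
    by rewrite lerXn2r ?nnegrE ?addr_ge0// ler_normD.
  have := normr_ge0 t; have := normr_ge0 t'; move: `|t| `|t'| => y z y0 z0.
  (* Convexity of the cube, with the difference of the two sides as an explicit nonnegative term. *)
  have -> : 4 * (y ^+ 3 + z ^+ 3) = (y + z) ^+ 3 + 3 * (y + z) * (y - z) ^+ 2 by ring.
  rewrite lerDl; apply: mulr_ge0; last exact: sqr_ge0.
  by apply: mulr_ge0 => //; exact: addr_ge0.
- rewrite natr_absz intr_norm c2E !normrM normr_nat !exprMn.
  rewrite mulrCA; apply: (@le_trans _ _ (31 * (B * r ^+ 2))); last by lra.
  exact: ler_pM.
Qed.

End CubicImage.

(** * Upper bound for trisection numbers of bounded height *)

(** With [n] the integer cube root of [T], all coefficients lie in [[- n, n]], which leaves at most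
    [2 * (2 * n + 1) ^ 3] roots. As [1 <= n], this is at most [2 * (3 * n) ^ 3 = 54 * n ^ 3]. *)
Lemma ncard_cubic_quadratic_roots (R : realType) (T : R) (A : set R) :
  1 <= T ->
  (forall x, A x -> exists t (c : int * int * int), [/\ t ^+ 3 - 3 * t = x,
    c.1.1 != 0, c.1.1%:~R * t ^+ 2 + c.1.2%:~R * t + c.2%:~R = 0 &
    [/\ `|c.1.1|%N%:R ^+ 3 <= T, `|c.1.2|%N%:R ^+ 3 <= T & `|c.2|%N%:R ^+ 3 <= T]]) ->
  (ncard A)%:R <= 54 * T.
Proof.
move=> T1 AT; have T0 : 0 <= T by exact: le_trans T1.
have ex : exists n : nat, n%:R ^+ 3 <= T by exists 1%N; rewrite expr1n.
have bnd (n : nat) : n%:R ^+ 3 <= T -> (n <= Num.truncn T)%N.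
  move=> nT; rewrite truncn_ge_nat//; apply: le_trans nT.
  by rewrite -natrX ler_nat; case: n => // n; rewrite -{1}[n.+1]expn1 leq_pexp2l.
case: (ex_maxnP ex bnd) => n nT nmax.
have n1 : (0 < n)%N by apply: nmax; rewrite expr1n.
pose sh (i : 'I_(n.*2.+1)) : int := i%:Z - n%:Z.
have shP (c : int) : `|c|%N%:R ^+ 3 <= T -> exists i, c = sh i.
  move=> /nmax; rewrite -lez_nat abszE ler_norml => cn.
  have ci : (`|(c + n%:Z)%R| < n.*2.+1)%N by lia.
  by exists (Ordinal ci); rewrite /sh/=; lia.
(* The boolean selects the sign in the quadratic formula. Values at triples without real roots are
   harmless, since [f] only has to cover [A]. *)
pose root (c : int * int * int) (s : bool) : R :=
  (- c.1.2%:~R + (-1) ^+ s * Num.sqrt (c.1.2%:~R ^+ 2 - 4 * c.1.1%:~R * c.2%:~R)) /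
  (2 * c.1.1%:~R).
pose f (u : 'I_(n.*2.+1) * 'I_(n.*2.+1) * 'I_(n.*2.+1) * bool) : R :=
  let t := root (sh u.1.1.1, sh u.1.1.2, sh u.1.2) u.2 in t ^+ 3 - 3 * t.
have Af : A `<=` range f.
  move=> x /AT[t [[[c0 c1] c2] /= [<- c00 E [/shP[i iE] /shP[j jE] /shP[l lE]]]]].
  have c0R : c0%:~R != 0 :> R by rewrite intr_eq0.
  (* The sign is that of [2 * c0 * t + c1], whose square is the discriminant. *)
  exists (i, j, l, 2 * c0%:~R * t + c1%:~R < 0) => //=.
  suff tE : t = root (c0, c1, c2) (2 * c0%:~R * t + c1%:~R < 0).
    by rewrite /f/= -iE -jE -lE -tE.
  rewrite /root/=.
  have -> : c1%:~R ^+ 2 - 4 * c0%:~R * c2%:~R = (2 * c0%:~R * t + c1%:~R) ^+ 2.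
    rewrite -[LHS]addr0 -[0](mulr0 (4 * c0%:~R)) -E; ring.
  by rewrite sqrtr_sqr -[X in _ + X]realEsign ?num_real//; field.
apply: (@le_trans _ _ (54 * n%:R ^+ 3)); last by rewrite ler_wpM2l.
rewrite -natrX -natrM ler_nat (leq_trans (ncard_leq_card Af))//.
rewrite !card_prod !card_ord card_bool.
have -> : (54 * n ^ 3 = (3 * n) * (3 * n) * (3 * n) * 2)%N by rewrite !expnS expn0; lia.
by rewrite leq_mul// !leq_mul//; lia.
Qed.

(** The bounds for degrees 1 and 2 are brought to the common form [C * r ^+ k.+1], to which the
    count of roots applies. *)
Lemma Tri_card_le (R : realType) (K : {pred R}) k (v : 'I_k.+1 -> R) :
  divring_closed K -> rat_basis K v -> (k.+1 <= 2)%N -> exists2 C : R, 0 < C &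
  forall r, 1 <= r ->
    (ncard (Tri `&` height_ball K v r `&` `[(- 2)%R, 2%R]))%:R <= C * r ^+ k.+1.
Proof.
move=> Kfield vB k2.
have [C C1 H] : exists2 C : R, 1 <= C &
  forall r x t, 1 <= r -> height_ball K v r x -> `|x| <= 2 -> t \in K ->
    t ^+ 3 - 3 * t = x -> exists c : int * int * int,
    [/\ c.1.1 != 0, c.1.1%:~R * t ^+ 2 + c.1.2%:~R * t + c.2%:~R = 0,
        `|c.1.1|%N%:R ^+ 3 <= C * r ^+ k.+1, `|c.1.2|%N%:R ^+ 3 <= C * r ^+ k.+1
      & `|c.2|%N%:R ^+ 3 <= C * r ^+ k.+1].
  case: k v vB k2 => [|[|//]] v vB _.
    have [C C1 H] := rational_quadratic_root Kfield vB.
    by exists C => //; under [X in forall r, X]eq_forall do rewrite expr1.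
  exact: quadratic_quadratic_root.
exists (54 * C) => [|r r1]; first by lra.
rewrite -mulrA; apply: ncard_cubic_quadratic_roots.
  by rewrite -[1]mulr1 ler_pM// exprn_ege1.
move=> x [[Trix xball]]; rewrite /= in_itv/= -ler_norml => x2.
have sK : subfield [set` K] by case: Kfield.
have [t tK tx] := Tri_cubic_root sK xball.1 Trix.
by have [c [? ? ? ? ?]] := H r x t r1 xball x2 tK tx; exists t, c.
Qed.

(** * Comparison of the two counts *)

Unset Implicit Arguments.
Set Strict Implicit.

Theorem theorem1p1 (R : realType) (K : {pred R}) (K_subfield : divring_closed K)
    (k : nat) (v : 'I_k -> R) (v_basis : rat_basis K v) (k_le2 : (k <= 2)%N) :
  density Tri K v r @[r --> +oo] --> (0 : R).
Proof.
case: k v v_basis k_le2 => [|k] v v_basis k_le2.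
  (* An empty basis spans only 0, whereas 1 is in [K]. *)
  have [K1 _ _] := K_subfield; have [_ _ /(_ _ K1)[q /eqP]] := v_basis.
  by rewrite big_ord0 oner_eq0.
have [C C0 upper] := Tri_card_le K_subfield v_basis k_le2.
have [W W0 lower] := height_ball_card_ge K_subfield v_basis.
apply/cvgrPdist_le => e e0.
(* The quotient is at most [C * (W * m) ^+ k.+1 / (L * m ^+ k.+1) = C * W ^+ k.+1 / L], which this
   [L] brings below [e]; [C] and [W] were fixed before [L]. *)
pose L := (Num.truncn (C * W%:R ^+ k.+1 / e)).+1.
near=> r.
have r1 : 1 <= r by near: r; apply: nbhs_pinfty_ge; rewrite num_real.
have rW : (W * 2 ^ L)%N%:R <= r by near: r; apply: nbhs_pinfty_ge; rewrite num_real.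
have [m [m0 rm]] := lower _ _ rW.
rewrite sub0r normrN /density; set N := ncard _; set M := ncard _ => LN.
have Lm0 : (0 < L * m ^ k.+1)%N by rewrite muln_gt0 expn_gt0 m0.
have N0 : 0 < N%:R :> R by rewrite ltr0n (leq_trans Lm0 LN).
rewrite ger0_norm ?divr_ge0 ?ler0n// ler_pdivrMr//.
apply: le_trans (upper r r1) _.
apply: (@le_trans _ _ (C * (W * m)%N%:R ^+ k.+1)).
  apply: ler_wpM2l; first exact: ltW.
  by apply: lerXn2r => //; rewrite nnegrE ?ler0n// (le_trans _ r1).
apply: (@le_trans _ _ (e * (L * m ^ k.+1)%N%:R)); last first.
  by rewrite ler_wpM2l ?ler_nat// ltW.
rewrite !natrM natrX exprMn !mulrA ler_wpM2r ?exprn_ge0 ?ler0n//.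
by rewrite [e * _]mulrC -ler_pdivrMr// ltW// truncnS_gt.
Unshelve. all: by end_near.
Qed.
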